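(* Let $N\ge 1$ and let $X=\{X_t;\ t\in\mathbf{R}^N_+\}$ be a cadlag (right continuous with left limits) real-valued stochastic process. Let $t_0\in\mathbf{R}^N_+$ and assume that almost surely the graph $\{(s',\boldsymbol{\sigma}_{t_0}(s')) : s'<0\}$ meets the region $D$. Assume that there exist two constants $C>0$ and $\rho_0>0$ such that $$\forall\, 0<\rho<\rho_0,\ \forall t,u\in B(t_0,\rho);\quad E\left[|X_t-X_u|^{\eta}\right]\le C\,\|t-u\|^{N+\mu}\,\rho^{-\nu},$$ with $\eta>0$, $\mu>0$ and $\nu<0$. Then, almost surely, the paths of $X$ belong to $C^{\sigma-\nu/\eta,\,\nu/\eta}_{t_0}$ for all $\sigma<\mu/\eta$. In other words, the $2$-microlocal frontier of $X$ at $t_0$ satisfies $$\boldsymbol{\sigma}_{t_0}\left(\frac{\nu}{\eta}\right)\ge\frac{\mu}{\eta}\quad\text{almost surely.}$$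
   Context: $\mathbf{R}^N_+=[0,\infty)^N$ with norm $\|\cdot\|$; $B(t_0,\rho)$ is the ball of centre $t_0$ and radius $\rho$ in $\mathbf{R}^N_+$; suprema of quotients with $\|t-u\|$ in the denominator are over $t\ne u$. The $2$-microlocal frontier of $X$ at $t_0$ is the random function defined for $s'\in(-\infty,0)$ by $$\boldsymbol{\sigma}_{t_0}(s')=\sup\Big\{\sigma:\ \limsup_{\rho\to0}\ \sup_{t,u\in B(t_0,\rho)}\frac{|X_t-X_u|}{\|t-u\|^{\sigma}\rho^{-s'}}<\infty\Big\}.$$ A function $f$ belongs to $C^{s,s'}_{t_0}$ if, with $\sigma=s+s'$, there are $\delta>0$ and $C>0$ such that $|f(t)-f(u)|\le C\|t-u\|^{\sigma}(\|t-t_0\|+\|t-u\|)^{-s'}$ for all $t,u$ with $0<\|t-t_0\|<\delta$, $0<\|u-t_0\|<\delta$. (This time-domain definition is the one the paper uses for parameters in the non-differentiable range.) The region is $D=\{(s',\sigma): -1<s'<0,\ 0<\sigma<1+s'\}$. *)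

(* Defs.v *)
From HB Require Import structures.
From mathcomp Require Import all_boot all_order all_algebra.
From mathcomp Require Import all_classical all_reals all_analysis.

Set Implicit Arguments.
Unset Strict Implicit.
Unset Printing Implicit Defensive.

Import Order.TTheory GRing.Theory Num.Theory.
Import numFieldNormedType.Exports.

Local Open Scope classical_set_scope.
Local Open Scope ring_scope.

Definition is_norm (R : realType) (N : nat) (nrm : 'rV[R]_N -> R) : Prop :=
  [/\ forall x, nrm x = 0 -> x = 0,
      forall (a : R) x, nrm (a *: x) = `|a| * nrm x &
      forall x y, nrm (x + y) <= nrm x + nrm y].

(* Functions on R^N_+ are represented by functions on R^N; the definitions
   below only inspect their values on the orthant. *)
Definition orthant (R : realType) (N : nat) : set 'rV[R]_N :=
  [set t | forall i, 0 <= t ord0 i].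

(* For the product order on R^N_+.  For N >= 2 this is weaker than the
   multiparameter notion requiring a limit from each of the 2^N quadrants. *)
Definition cadlag (R : realType) (N : nat) (f : 'rV[R]_N -> R) : Prop :=
  forall t : 'rV[R]_N, orthant t ->
    f u @[u --> within [set u : 'rV[R]_N | forall i, t ord0 i <= u ord0 i]
                  (nbhs t)] --> f t
    /\ exists l : R,
      f u @[u --> within [set u : 'rV[R]_N |
                   orthant u /\ forall i, u ord0 i < t ord0 i]
                  (nbhs t)] --> l.

Definition oball (R : realType) (N : nat) (nrm : 'rV[R]_N -> R)
    (t0 : 'rV[R]_N) (rho : R) : set 'rV[R]_N :=
  [set t | orthant t /\ nrm (t - t0) < rho].

Definition increment_sup (R : realType) (N : nat) (nrm : 'rV[R]_N -> R)
    (t0 : 'rV[R]_N) (f : 'rV[R]_N -> R) (sigma s' rho : R) : \bar R :=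
  ereal_sup
    [set (`|f tu.1 - f tu.2| /
            (nrm (tu.1 - tu.2) `^ sigma * rho `^ (- s')))%:E
    | tu in [set tu : 'rV[R]_N * 'rV[R]_N |
        [/\ oball nrm t0 rho tu.1, oball nrm t0 rho tu.2 & tu.1 != tu.2]]].

Definition frontier (R : realType) (N : nat) (nrm : 'rV[R]_N -> R)
    (t0 : 'rV[R]_N) (f : 'rV[R]_N -> R) (s' : R) : \bar R :=
  ereal_sup
    [set sigma%:E | sigma in [set sigma : R |
       (limf_esup (increment_sup nrm t0 f sigma s') (0 : R)^'+ < +oo)%E]].

Definition frontier_graph (R : realType) (N : nat) (nrm : 'rV[R]_N -> R)
    (t0 : 'rV[R]_N) (f : 'rV[R]_N -> R) : set (R * \bar R) :=
  [set (s', frontier nrm t0 f s') | s' in [set s' : R | s' < 0]].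

Definition regionD (R : realType) : set (R * \bar R) :=
  [set p | [/\ -1 < p.1, p.1 < 0, (0 < p.2)%E & (p.2 < (1 + p.1)%:E)%E]].

Definition microlocal (R : realType) (N : nat) (nrm : 'rV[R]_N -> R)
    (t0 : 'rV[R]_N) (s s' : R) (f : 'rV[R]_N -> R) : Prop :=
  exists delta C : R, [/\ 0 < delta, 0 < C &
    forall t u, orthant t -> orthant u ->
      0 < nrm (t - t0) < delta -> 0 < nrm (u - t0) < delta ->
      `|f t - f u| <=
        C * nrm (t - u) `^ (s + s')
          * (nrm (t - t0) + nrm (t - u)) `^ (- s')].

(* Main.v *)
(* Kolmogorov's chaining argument, localised at t0.  With gamma = - nu / eta, give
   the increment of X along an edge {v, v + e / 2^k} of the level-k dyadic grid
   (e in {0,1}^N) the weight w = |v - t0| + 2^-k.  The moment bound says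
   E |X_v - X_(v + e / 2^k)|^eta <= C' 2^(-k (N + mu)) w^(- nu), and there are
   O(2^(k N)) edges near t0 at level k, so for sigma < mu / eta the sum over all
   edges of 2^(k sigma eta) w^nu |X_v - X_(v + e / 2^k)|^eta has finite
   expectation.  Almost surely, therefore, every such increment is at most
   K 2^(- k sigma) w^gamma.  Approximating t and u from above by grid points
   (right-continuity) and summing a geometric series along the chain joining them
   yields |X_t - X_u| <= K' |t - u|^sigma (|t - t0| + |t - u|)^gamma near t0. *)
Require Import Defs.
From HB Require Import structures.
From mathcomp Require Import all_boot all_order all_algebra.
From mathcomp Require Import all_classical all_reals all_analysis.
From mathcomp Require Import measurable_realfun.
From mathcomp Require Import ring lra zify.

Import Order.TTheory GRing.Theory Num.Theory.
Import numFieldNormedType.Exports.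

Local Open Scope classical_set_scope.
Local Open Scope ring_scope.

(** * Equivalence of an arbitrary norm with the max norm on row vectors *)

Section MaxNorm.
Context {R : realType} {N : nat}.
Implicit Types x y : 'rV[R]_N.

Lemma coord_le_norm x i : `|x ord0 i| <= `|x|.
Proof.
rewrite [leRHS]/Num.norm /= mx_normrE.
by apply: (le_bigmax _ (fun ij : 'I_1 * 'I_N => `|x ij.1 ij.2|) (ord0, i)).
Qed.

Lemma norm_le_coord x (a : R) : 0 <= a -> (forall i, `|x ord0 i| <= a) -> `|x| <= a.
Proof.
move=> a0 xa; rewrite [leLHS]/Num.norm /= mx_normrE; apply/bigmax_leP; split=> //.
by move=> [i j] _ /=; rewrite (ord1 i).
Qed.

Context {nrm : 'rV[R]_N -> R} (hnrm : is_norm nrm).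

Lemma is_norm0 : nrm 0 = 0.
Proof. by case: hnrm => _ /(_ 0 0) + _; rewrite scale0r normr0 mul0r. Qed.

Lemma is_normN x : nrm (- x) = nrm x.
Proof. by case: hnrm => _ nZ _; rewrite -scaleN1r nZ normrN1 mul1r. Qed.

Lemma is_norm_ge0 x : 0 <= nrm x.
Proof.
case: (hnrm) => _ _ /(_ x (- x)).
by rewrite subrr is_norm0 is_normN -mulr2n pmulrn_lge0.
Qed.

Lemma is_norm_gt0 x : x != 0 -> 0 < nrm x.
Proof.
move=> x0; rewrite lt_neqAle is_norm_ge0 andbT eq_sym.
by apply: contra x0 => /eqP; case: hnrm => + _ _ => /[apply] ->.
Qed.

(** Expansion in the standard basis and the triangle inequality bound [nrm] by the sum of its values
    on the basis vectors; adding 1 keeps the constant positive. *)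
Lemma is_norm_le_max : exists2 A : R, 0 < A & forall x, nrm x <= A * `|x|.
Proof.
case: (hnrm) => _ nZ nD.
exists (1 + \sum_(i < N) nrm (delta_mx ord0 i)).
  by rewrite ltr_pwDl// sumr_ge0// => i _; exact: is_norm_ge0.
move=> x; rewrite mulrDl mul1r ler_wpDl//.
have -> : nrm x = nrm (\sum_(i < N) x ord0 i *: delta_mx ord0 i).
  by rewrite -row_sum_delta.
rewrite mulr_suml; elim/big_ind2 : _ => [|y a z b ya zb|i _].
- by rewrite is_norm0.
- exact: le_trans (nD _ _) (lerD _ _).
- by rewrite nZ mulrC ler_wpM2l// ?is_norm_ge0// coord_le_norm.
Qed.

Lemma is_norm_continuous : continuous nrm.
Proof.
case: (hnrm) => _ nZ nD; case: is_norm_le_max => A A0 nA x.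
apply/(@cvgrPdist_le R R^o 'rV[R]_N (nbhs x)) => e e0.
near=> y.
have xy : `|x - y| <= e / A.
  by near: y; apply: cvgr_dist_le; [exact: cvg_id | exact: divr_gt0].
have nxy : nrm (x - y) <= e.
  by apply: (le_trans (nA _)); rewrite mulrC -ler_pdivlMr.
have h1 : nrm x <= nrm (x - y) + nrm y by rewrite -{1}(subrK y x) nD.
have h2 : nrm y <= nrm (x - y) + nrm x.
  by rewrite -(is_normN (x - y)) opprB -{1}(subrK x y) nD.
rewrite ler_norml; apply/andP; split; lra.
Unshelve. all: by end_near. Qed.

(** The continuous function [nrm] attains a positive minimum on the compact unit sphere of the max
    norm; by homogeneity its inverse serves as the constant. *)
Lemma max_le_is_norm : exists2 B : R, 0 < B & forall x, `|x| <= B * nrm x.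
Proof.
have S0 x : x != 0 -> `| `|x|^-1 *: x | = 1.
  by move=> x0; rewrite normrZ normfV normr_id mulVf ?normr_eq0.
have cptS : compact [set x : 'rV[R]_N | `|x| = 1].
  apply: bounded_closed_compact.
    by exists 1; split => // M M1 x /= x1; rewrite x1 ltW.
  rewrite [X in closed X](_ : _ = (fun x : 'rV[R]_N => `|x|) @^-1` [set 1])//.
  apply: preimage_closed; last exact: closed_eq.
  by move=> x _; exact: norm_continuous.
(* The sphere is empty when N = 0; every vector is then zero and any constant works. *)
have [Sn|Se] := pselect ([set x : 'rV[R]_N | `|x| = 1] !=set0); last first.
  exists 1 => // x; have [->|x0] := eqVneq x 0.
    by rewrite normr0 is_norm0 mulr0.
  by case: Se; exists (`|x|^-1 *: x); exact: S0.
have [c cS cmin] := compact_EVT_min Sn cptS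
  (continuous_subspaceT is_norm_continuous).
have c0 : 0 < nrm c.
  apply: is_norm_gt0; apply/eqP => c0; move: cS.
  by rewrite inE /= c0 normr0 => /eqP; rewrite eq_sym oner_eq0.
exists (nrm c)^-1 => [|x]; first by rewrite invr_gt0.
have [->|x0] := eqVneq x 0; first by rewrite normr0 is_norm0 mulr0.
have := cmin (`|x|^-1 *: x); rewrite inE /= => /(_ (S0 _ x0)).
case: (hnrm) => _ nZ _; rewrite nZ normfV normr_id.
by rewrite ler_pdivlMl ?normr_gt0// => h; rewrite ler_pdivlMl// mulrC.
Qed.

End MaxNorm.

(** * Choice of a dyadic scale, with the integer arithmetic for neighbouring vertices *)

Lemma minn_add_neq (a b : nat) : (a <= b.+1)%N -> (a = minn a b + (a != minn a b))%N.
Proof. by case: eqP => /=; lia. Qed.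

Lemma ex_half_expr_lt (R : realType) (x : R) : 0 < x -> exists n, 2^-1 ^+ n < x.
Proof.
move=> x0; have := @cvg_geometric R 1 2^-1.
rewrite ger0_norm // invf_lt1 // ltr1n => /(_ isT).
move=> /(@cvgrPdist_lt R R^o) /(_ _ x0)[n _ /(_ n (leqnn n))] /=.
by rewrite sub0r normrN mul1r ger0_norm ?exprn_ge0 // => ?; exists n.
Qed.

Lemma half_expr_bracket (R : realType) (x : R) : 0 < x < 1 ->
  exists k, 2^-1 ^+ k.+1 < x <= 2^-1 ^+ k.
Proof.
move=> /andP[x0 x1]; case: (ex_minnP (ex_half_expr_lt _ _ x0)) => -[|k].
  by rewrite expr0 => /lt_trans /(_ x1); rewrite ltxx.
move=> kx kmin; exists k; rewrite kx leNgt /=; apply/negP => /kmin.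
by rewrite ltnn.
Qed.

(** * Deterministic chaining: from grid increments to a modulus of continuity at [t0] *)

Section DyadicChaining.
Context {R : realType} {N : nat}.
Implicit Types (t u : 'rV[R]_N) (v : 'I_N -> nat).

Definition dyadic (k : nat) v : 'rV[R]_N := \row_i ((v i)%:R / 2 ^+ k).

(* The dyadic point of level [k] just above [t] in every coordinate, so that
   right-continuity suffices to pass to the limit. *)
Definition above (k : nat) t (i : 'I_N) : nat := (Num.truncn (t ord0 i * 2 ^+ k)).+1.

Lemma above_itv k t i : orthant t ->
  t ord0 i < dyadic k (above k t) ord0 i <= t ord0 i + 2^-1 ^+ k.
Proof.
move=> ot; have h0 : 0 < 2 ^+ k :> R by rewrite exprn_gt0.
have /truncn_itv/andP[lo hi] : 0 <= t ord0 i * 2 ^+ k by rewrite mulr_ge0 ?ot // ltW.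
rewrite mxE ltr_pdivlMr // hi /= ler_pdivrMr // mulrDl -exprMn mulVf // expr1n.
by rewrite /above -addn1 natrD lerD2r.
Qed.

Lemma above_dist k t : orthant t -> `|dyadic k (above k t) - t| <= 2^-1 ^+ k.
Proof.
move=> ot; apply: norm_le_coord => [|i]; first by rewrite exprn_ge0.
have /andP[lo hi] := @above_itv k t i ot.
have -> : (dyadic k (above k t) - t) ord0 i = dyadic k (above k t) ord0 i - t ord0 i.
  by rewrite !mxE.
by rewrite ger0_norm ?subr_ge0 ?(ltW lo) // lerBlDl.
Qed.

Lemma dyadic_double k v : dyadic k v = dyadic k.+1 (fun i => (v i).*2).
Proof.
apply/rowP => i; rewrite !mxE exprS -muln2 natrM.
by field; rewrite expf_neq0.
Qed.

(** With m the integer part of x, that of 2x is 2m or 2m + 1. Hence the coarse point above [t] is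
    the fine one plus a 0/1 vector, and changing level costs a single edge. *)
Lemma above_succ k t i : orthant t ->
  exists e : bool, (above k t i).*2 = (above k.+1 t i + e)%N.
Proof.
move=> ot; have ox : 0 <= t ord0 i * 2 ^+ k by rewrite mulr_ge0 ?ot // exprn_ge0.
rewrite /above; set x := t ord0 i * 2 ^+ k in ox *.
have -> : t ord0 i * 2 ^+ k.+1 = x * 2 by rewrite exprS /x; ring.
have /andP[lo hi] := truncn_itv ox; set m := Num.truncn x in lo hi *.
have x20 : 0 <= x * 2 by rewrite mulr_ge0.
have h1 : (m.*2 <= Num.truncn (x * 2))%N.
  by rewrite truncn_ge_nat // -muln2 natrM ler_pM2r.
have h2 : (Num.truncn (x * 2) < m.+1.*2)%N.
  by rewrite truncn_lt_nat // -[m.+1.*2]muln2 natrM ltr_pM2r.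
(* The coarse index doubles to 2m + 2, while the fine one is 2m + 1 exactly when the integer part of
   2x is 2m. *)
exists (Num.truncn (x * 2) == m.*2); case: eqP => /= h; lia.
Qed.

(** After scaling by 2^k the coordinates differ by at most 1, hence so do their integer parts. This
    lets nearby points share a vertex at level [k]. *)
Lemma above_near k t u i : orthant t -> orthant u -> `|t - u| <= 2^-1 ^+ k ->
  (above k t i <= (above k u i).+1)%N.
Proof.
move=> ot ou tu; rewrite /above ltnS.
have h0 : 0 < 2 ^+ k :> R by rewrite exprn_gt0.
have x0 : 0 <= t ord0 i * 2 ^+ k by rewrite mulr_ge0 ?ot // ltW.
have y0 : 0 <= u ord0 i * 2 ^+ k by rewrite mulr_ge0 ?ou // ltW.
have xy : t ord0 i * 2 ^+ k <= u ord0 i * 2 ^+ k + 1.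
  rewrite -lerBlDl -mulrBl.
  have := le_trans (coord_le_norm (t - u) i) tu; rewrite !mxE => tu_i.
  have {tu_i} := le_trans (ler_norm _) tu_i.
  by rewrite -(ler_pM2r h0) -exprMn mulVf // expr1n.
have /andP[_ hy] := truncn_itv y0.
rewrite -ltnS truncn_lt_nat //; apply: (le_lt_trans xy).
by rewrite -[in ltRHS]addn1 natrD ltrD2r.
Qed.

Lemma dyadicD_dist k v (e : 'I_N -> bool) :
  `|dyadic k v - dyadic k (fun i => v i + e i)%N| <= 2^-1 ^+ k.
Proof.
apply: norm_le_coord => [|i]; first by rewrite exprn_ge0.
rewrite !mxE natrD mulrDl opprD addNKr normrN exprVn.
case: (e i); rewrite ?mul0r ?normr0 ?invr_ge0 ?exprn_ge0 //.
by rewrite mul1r ger0_norm // invr_ge0 exprn_ge0.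
Qed.

Lemma orthant_dyadic k v : orthant (dyadic k v).
Proof. by move=> i; rewrite mxE divr_ge0 // exprn_ge0. Qed.

Context (f : 'rV[R]_N -> R) (t0 : 'rV[R]_N) (r0 sigma gamma K : R).
Hypotheses (r0_gt0 : 0 < r0) (sigma_gt0 : 0 < sigma).
Hypotheses (gamma_ge0 : 0 <= gamma) (K_ge0 : 0 <= K).
Hypothesis f_right : forall t, orthant t ->
  f u @[u --> within [set u : 'rV[R]_N | forall i, t ord0 i <= u ord0 i] (nbhs t)] --> f t.
Hypothesis f_dyadic : forall k v (e : 'I_N -> bool),
  `|dyadic k v - t0| + 2^-1 ^+ k < r0 ->
  `|f (dyadic k v) - f (dyadic k (fun i => v i + e i)%N)| <=
    K * (2^-1 ^+ k) `^ sigma * (`|dyadic k v - t0| + 2^-1 ^+ k) `^ gamma.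

(** Since [gamma] is nonnegative, the weight of each edge can be enlarged to one [W] common to a
    whole chain. *)
Lemma f_dyadic_le k v (e : 'I_N -> bool) (W : R) :
  `|dyadic k v - t0| + 2^-1 ^+ k <= W -> W < r0 ->
  `|f (dyadic k v) - f (dyadic k (fun i => v i + e i)%N)| <=
    K * (2^-1 ^+ k) `^ sigma * W `^ gamma.
Proof.
move=> wW Wr; apply: le_trans (f_dyadic _ _ _ (le_lt_trans wW Wr)) _.
have w0 : 0 <= `|dyadic k v - t0| + 2^-1 ^+ k by rewrite addr_ge0 // exprn_ge0.
rewrite ler_wpM2l ?mulr_ge0 ?powR_ge0 //.
by rewrite ge0_ler_powR ?nnegrE // (le_trans w0).
Qed.

(** Ratio of the geometric series formed by the increments along a chain. *)
Let q : R := 2^-1 `^ sigma.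

Lemma half_powR_lt1 : 0 < q < 1.
Proof.
rewrite powR_gt0 //= [ltRHS](_ : 1 = 1 `^ sigma); last by rewrite powR1.
by rewrite gt0_ltr_powR ?nnegrE //= invf_lt1 // ltr1n.
Qed.

Lemma half_expr_powR k : (2^-1 ^+ k) `^ sigma = q ^+ k :> R.
Proof. by rewrite -(@powR_mulrn _ 2^-1) // powRAC powR_mulrn // powR_ge0. Qed.

(** The step is one edge of level k + 1 based at the finer point, whose weight is at most |t - t0| +
    2 * 2^-(k+1), hence at most [W]. *)
Lemma above_step t k W : orthant t -> `|t - t0| + 2^-1 ^+ k <= W -> W < r0 ->
  `|f (dyadic k.+1 (above k.+1 t)) - f (dyadic k (above k t))| <=
    K * q ^+ k.+1 * W `^ gamma.
Proof.
move=> ot tW Wr; rewrite -half_expr_powR.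
have /choice[e he] i : exists e : bool, (above k t i).*2 = (above k.+1 t i + e)%N.
  exact: above_succ.
rewrite (dyadic_double k).
have -> : (fun i => (above k t i).*2) = (fun i => above k.+1 t i + e i)%N by exact/funext.
apply: f_dyadic_le => //; apply: le_trans tW.
have hk : 2^-1 ^+ k = 2^-1 ^+ k.+1 + 2^-1 ^+ k.+1 :> R by rewrite exprS; lra.
have := @above_dist k.+1 t ot.
have := ler_distD t (dyadic k.+1 (above k.+1 t)) t0; lra.
Qed.

(** Summing [above_step] over n levels; the last two factors are the closed form of q^(k+1) + ... +
    q^(k+n). *)
Lemma above_chain t k n W : orthant t -> `|t - t0| + 2^-1 ^+ k <= W -> W < r0 ->
  `|f (dyadic (k + n) (above (k + n) t)) - f (dyadic k (above k t))| <=
    K * W `^ gamma * q ^+ k * (q / (1 - q) * (1 - q ^+ n)).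
Proof.
move=> ot tW Wr; have /andP[q0 q1] := half_powR_lt1.
elim: n => [|n IHn]; first by rewrite addn0 subrr normr0 expr0 subrr !mulr0.
rewrite addnS; apply: le_trans (ler_distD (f (dyadic (k + n) (above (k + n) t))) _ _) _.
have -> : K * W `^ gamma * q ^+ k * (q / (1 - q) * (1 - q ^+ n.+1)) =
   K * q ^+ (k + n).+1 * W `^ gamma +
   K * W `^ gamma * q ^+ k * (q / (1 - q) * (1 - q ^+ n)).
  rewrite -addnS exprD !exprS; field; lra.
apply: lerD IHn; apply: above_step => //; apply: le_trans tW.
rewrite lerD2l exprD ler_piMr ?exprn_ge0 //.
by rewrite exprn_ile1 // invf_le1 // ler1n.
Qed.

(** The points above [t] converge to [t] within its upper quadrant, so right-continuity lets n tend
    to infinity in [above_chain], where 1 - q^n is at most 1. *)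
Lemma above_limit t k W : orthant t -> `|t - t0| + 2^-1 ^+ k <= W -> W < r0 ->
  `|f t - f (dyadic k (above k t))| <= K * W `^ gamma * q ^+ k * (q / (1 - q)).
Proof.
move=> ot tW Wr; have /andP[q0 q1] := half_powR_lt1.
apply/ler_addgt0Pr => e e0.
have /(@cvgrPdist_le R R^o) /(_ _ e0) := f_right _ ot.
move=> /nbhs_ballP[d /= d0 hd].
have [n hn] := ex_half_expr_lt _ _ d0.
have hkn : 2^-1 ^+ (k + n) < d.
  apply: le_lt_trans hn; rewrite exprD ler_piMl ?exprn_ge0 //.
  by rewrite exprn_ile1 // invf_le1 // ler1n.
have fn : `|f t - f (dyadic (k + n) (above (k + n) t))| <= e.
  apply: hd => [|i] /=; last by have /andP[/ltW] := @above_itv (k + n) t i ot.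
  by rewrite mx_norm_ball /ball_ /= distrC (le_lt_trans (above_dist _ _ _)).
apply: le_trans (ler_distD (f (dyadic (k + n) (above (k + n) t))) _ _) _.
rewrite addrC; apply: lerD => //.
apply: le_trans (above_chain _ _ n _ ot tW Wr) _.
rewrite ler_wpM2l ?mulr_ge0 ?powR_ge0 ?exprn_ge0 ?(ltW q0) //.
rewrite ler_piMr ?divr_ge0 ?subr_ge0 ?ltW //.
by rewrite ltrBlDl ltrDr exprn_gt0.
Qed.

Lemma dyadic_chaining : exists delta K', [/\ 0 < delta, 0 <= K' &
  forall t u, orthant t -> orthant u -> `|t - t0| < delta -> `|u - t0| < delta ->
   `|f t - f u| <= K' * `|t - u| `^ sigma * (`|t - t0| + `|t - u|) `^ gamma].
Proof.
have /andP[q0 q1] := half_powR_lt1.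
have c0 : 0 <= q / (1 - q) by apply: divr_ge0; [exact: ltW|rewrite subr_ge0 ltW].
exists (Num.min 4^-1 (r0 / 32)), (K * 7 `^ gamma * 2 `^ sigma * (2 * (q / (1 - q)) + 2)).
have K0 : 0 <= K * 7 `^ gamma * 2 `^ sigma * (2 * (q / (1 - q)) + 2).
  by rewrite !mulr_ge0 ?powR_ge0 // addr_ge0 // mulr_ge0.
split=> //; first by rewrite lt_min invr_gt0 divr_gt0 ?ltr0n.
move=> t u ot ou; rewrite !lt_min => /andP[td td'] /andP[ud ud'].
have [->|tu] := eqVneq t u.
  by rewrite subrr normr0 !(mulr_ge0 K0, mulr_ge0) ?powR_ge0.
have tu0 : 0 < `|t - u| by rewrite normr_gt0 subr_eq0.
have ttu : `|t - u| <= `|t - t0| + `|u - t0|.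
  by have := ler_distD t0 t u; rewrite (distrC t0).
have utu : `|u - t0| <= `|t - t0| + `|t - u|.
  by have := ler_distD t u t0; rewrite (distrC u t); lra.
have [k /andP[hk kh]] : exists k, 2^-1 ^+ k.+1 < `|t - u| <= 2^-1 ^+ k.
  by apply: half_expr_bracket; rewrite tu0 /=; lra.
set D := `|t - t0| + `|t - u|.
have D0 : 0 < D by rewrite ltr_wpDl.
have hk2 : 2^-1 ^+ k < 2 * `|t - u| by move: hk; rewrite exprS; lra.
have Wr : 7 * D < r0 by rewrite /D; lra.
have tW : `|t - t0| + 2^-1 ^+ k <= 7 * D.
  have := normr_ge0 (t - t0); rewrite /D; lra.
have uW : `|u - t0| + 2^-1 ^+ k <= 7 * D.
  have := normr_ge0 (t - t0); rewrite /D; lra.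
(* The coordinatewise minimum is a common lower corner: neighbouring indices both exceed it by 0 or
   1, so one edge joins [v] to the point above [t] and one to the point above [u]. *)
pose v i := minn (above k t i) (above k u i).
pose et i := above k t i != v i.
pose eu i := above k u i != v i.
have vt : above k t = (fun i => v i + et i)%N.
  by apply/funext => i; exact/minn_add_neq/above_near.
have vu : above k u = (fun i => v i + eu i)%N.
  apply/funext => i; rewrite /eu /v minnC; apply/minn_add_neq/above_near => //.
  by rewrite distrC.
(* Going from [v] to [t] through the point above [t] costs 2 * 2^-k, so the weight is at most |t -
   t0| + 3 * 2^-k, below |t - t0| + 6 |t - u|. *)
have vW : `|dyadic k v - t0| + 2^-1 ^+ k <= 7 * D.
  have := ler_distD (dyadic k (above k t)) (dyadic k v) t0.
  have := ler_distD t (dyadic k (above k t)) t0.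
  have := @above_dist k t ot; have := @dyadicD_dist k v et; rewrite -vt.
  have := normr_ge0 (t - t0); rewrite /D; lra.
have ft := above_limit _ _ _ ot tW Wr.
have fu := above_limit _ _ _ ou uW Wr.
have mt := @f_dyadic_le k v et (7 * D) vW Wr.
have mu := @f_dyadic_le k v eu (7 * D) vW Wr.
rewrite -vt half_expr_powR in mt; rewrite -vu half_expr_powR in mu.
have : `|f t - f u| <= K * (7 * D) `^ gamma * q ^+ k * (2 * (q / (1 - q)) + 2).
  have := ler_distD (f (dyadic k (above k t))) (f t) (f u).
  have := ler_distD (f (dyadic k v)) (f (dyadic k (above k t))) (f u).
  have := ler_distD (f (dyadic k (above k u))) (f (dyadic k v)) (f u).
  rewrite (distrC (f (dyadic k (above k t))) (f (dyadic k v))).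
  rewrite (distrC (f (dyadic k (above k u))) (f u)).
  lra.
move/le_trans; apply.
have qtu : q ^+ k <= 2 `^ sigma * `|t - u| `^ sigma.
  rewrite -half_expr_powR -powRM // ge0_ler_powR ?nnegrE ?mulr_ge0 ?exprn_ge0 //; exact: ltW.
rewrite powRM // ?(ltW D0) //; set c := 2 * _ + 2.
rewrite [leLHS](_ : _ = K * 7 `^ gamma * c * D `^ gamma * q ^+ k); last by ring.
rewrite [leRHS](_ : _ = K * 7 `^ gamma * c * D `^ gamma *
  (2 `^ sigma * `|t - u| `^ sigma)); last by ring.
by rewrite ler_wpM2l // !mulr_ge0 ?powR_ge0 // addr_ge0 // mulr_ge0.
Qed.

End DyadicChaining.

(** * Almost sure bounds for the increments on the dyadic grid *)

Lemma nneseries_geometric_lty (R : realType) (a q : R) : 0 <= a -> 0 < q < 1 ->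
  (\sum_(k <oo) (a * q ^+ k)%:E < +oo)%E.
Proof.
move=> a0 /andP[q0 q1].
have nn n : (0 <= (a * q ^+ n)%:E)%E by rewrite lee_fin mulr_ge0 // exprn_ge0 // ltW.
apply: (@le_lt_trans _ _ (a * (1 - q)^-1)%:E); last exact: ltry.
apply: lime_le; first by apply: is_cvg_nneseries => n _ _; exact: nn.
apply: nearW => n; rewrite sumEFin lee_fin.
by apply: geometric_le_lim => //; rewrite ger0_norm // ltW.
Qed.

(** By monotone convergence the series of the [g k] is integrable, hence almost everywhere finite,
    and its sum dominates each nonnegative term. *)
Lemma ae_bounded_summable_integral d (T : measurableType d) (R : realType)
    (m : {measure set T -> \bar R}) (g : nat -> T -> \bar R) :
  (forall k, measurable_fun [set: T] (g k)) -> (forall k w, 0 <= g k w)%E ->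
  (\sum_(k <oo) \int[m]_w g k w < +oo)%E ->
  {ae m, forall w, exists2 S : R, 0 <= S & forall k, (g k w <= S%:E)%E}.
Proof.
move=> mg g0 gy.
have sg0 w : (0 <= \sum_(k <oo) g k w)%E by apply: nneseries_ge0 => k _ _; exact: g0.
have : m.-integrable setT (fun w => \sum_(k <oo) g k w)%E.
  apply/integrableP; split; first exact: ge0_emeasurable_sum.
  by under eq_integral do rewrite gee0_abs //; rewrite integral_nneseries.
move=> /(integrable_ae measurableT); apply: filterS => w /(_ Logic.I) fw.
exists (fine (\sum_(k <oo) g k w)%E) => [|k]; first exact: fine_ge0.
rewrite fineK // (@nneseriesD1 _ (g ^~ w) k xpredT) // leeDl //.
by apply: nneseries_ge0 => j _ _; exact: g0.
Qed.

Section DyadicMoments.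
Context {R : realType} {d : measure_display} {T : measurableType d} (P : probability T R).
Context {N : nat} (X : 'rV[R]_N -> {RV P >-> R}) (t0 : 'rV[R]_N).
Context (r0 eta mu nu sigma C : R).
Hypotheses (eta_gt0 : 0 < eta) (C_ge0 : 0 <= C) (sigma_mu : sigma * eta < mu).

Let weight k (v : 'I_N -> nat) : R := `|dyadic k v - t0| + 2^-1 ^+ k.
Let incr k (v : 'I_N -> nat) (e : 'I_N -> bool) w : R :=
  X (dyadic k v) w - X (dyadic k (fun i => v i + e i)%N) w.

Hypothesis moment : forall k v e, weight k v < r0 ->
  (\int[P]_w (`|incr k v e w| `^ eta)%:E <=
   (C * (2^-1 ^+ k) `^ (N%:R + mu) * weight k v `^ (- nu))%:E)%E.

Let weight_gt0 k v : 0 < weight k v.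
Proof. by rewrite ltr_wpDl // exprn_gt0. Qed.

(** The factor 2^(k sigma eta) w^nu that normalises an increment, set to 0 where the moment bound is
    not assumed. *)
Let coeff k v : R :=
  if weight k v < r0 then (2^-1 ^+ k) `^ (- (sigma * eta)) * weight k v `^ nu else 0.

Let coeff_ge0 k v : 0 <= coeff k v.
Proof. by rewrite /coeff; case: ifP => // _; rewrite mulr_ge0 // powR_ge0. Qed.

Let measurable_incr k v e : measurable_fun [set: T] (fun w => (`|incr k v e w| `^ eta)%:E).
Proof.
apply/measurable_EFinP.
apply: (@measurableT_comp _ _ _ _ _ _ (fun x : R => x `^ eta)).
  exact: measurable_powR.
by apply: measurableT_comp => //; exact: measurable_funB.
Qed.

(** The powers w^nu and w^(- nu) cancel, leaving a bound that depends on the level only. *)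
Let integral_term k v e :
  (\int[P]_w ((coeff k v)%:E * (`|incr k v e w| `^ eta)%:E) <=
   (C * (2^-1 ^+ k) `^ (N%:R + mu - sigma * eta))%:E)%E.
Proof.
rewrite ge0_integralZl_EFin //.
rewrite /coeff; case: ifPn => wr; last first.
  by rewrite mul0e lee_fin mulr_ge0 // powR_ge0.
have h0 : 0 < 2^-1 ^+ k :> R by rewrite exprn_gt0.
have c0 : (0 <= ((2^-1 ^+ k) `^ (- (sigma * eta)) * weight k v `^ nu)%:E)%E.
  by rewrite lee_fin mulr_ge0 // powR_ge0.
apply: (le_trans (lee_wpmul2l c0 (moment k v e wr))).
rewrite -EFinM lee_fin powRN powRB ?(gt_eqF h0) ?implybT //.
rewrite powRN le_eqVlt; apply/orP; left; apply/eqP.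
have := powR_gt0 nu (weight_gt0 k v); have := powR_gt0 (sigma * eta) h0.
by move=> a0 b0; field; rewrite !gt_eqF.
Qed.

Lemma ae_dyadic_increments :
  {ae P, forall w, exists2 K : R, 0 <= K & forall k (v : 'I_N -> nat) (e : 'I_N -> bool),
    `|dyadic k v - t0| + 2^-1 ^+ k < r0 ->
    `|X (dyadic k v) w - X (dyadic k (fun i => v i + e i)%N) w| <=
      K * (2^-1 ^+ k) `^ sigma * (`|dyadic k v - t0| + 2^-1 ^+ k) `^ (- (nu / eta))}.
Proof.
(* A vertex of weight below [r0] has coordinates below |t0| + r0 < M, so its indices are below M *
   2^k and each level is a sum over a finite type. *)
pose M := (Num.truncn (`|t0| + r0)).+1.
pose I k := ({ffun 'I_N -> 'I_(M * 2 ^ k)} * {ffun 'I_N -> bool})%type.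
pose vI k (i : I k) : 'I_N -> nat := fun j => i.1 j.
pose eI k (i : I k) : 'I_N -> bool := fun j => i.2 j.
pose g k w := (\sum_(i : I k)
  (coeff k (vI k i))%:E * (`|incr k (vI k i) (eI k i) w| `^ eta)%:E)%E.
have mterm k v e : measurable_fun [set: T]
    (fun w => ((coeff k v)%:E * (`|incr k v e w| `^ eta)%:E)%E).
  exact: measurable_funeM.
have term0 k v e w : (0 <= (coeff k v)%:E * (`|incr k v e w| `^ eta)%:E)%E.
  by rewrite mule_ge0 // lee_fin ?powR_ge0.
(* There are (M 2^k)^N * 2^N terms; the factor 2^(k N) is absorbed by 2^(- k N) from the moment
   exponent, and the remaining ratio 2^-(mu - sigma eta) is below 1. *)
have g_bound k : (\int[P]_w g k w <=
    (C * (M * 2)%:R ^+ N * (2^-1 `^ (mu - sigma * eta)) ^+ k)%:E)%E.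
  rewrite /g ge0_integral_sum //.
  apply: le_trans (lee_sum _ (fun i _ => integral_term k (vI k i) (eI k i))) _.
  rewrite sumEFin lee_fin sumr_const card_prod !card_ffun !card_ord card_bool.
  have h0 : 0 < 2^-1 ^+ k :> R by rewrite exprn_gt0.
  rewrite -[leLHS]mulr_natr -addrA [X in C * X]powRD ?(gt_eqF h0) ?implybT //.
  rewrite powR_mulrn ?(ltW h0) //.
  have -> : (2^-1 ^+ k) `^ (mu - sigma * eta) = (2^-1 `^ (mu - sigma * eta)) ^+ k :> R.
    by rewrite -(@powR_mulrn _ 2^-1) // powRAC powR_mulrn // powR_ge0.
  rewrite natrM !natrX !natrM !exprMn natrX le_eqVlt; apply/orP; left; apply/eqP.
  have -> : (2^-1 ^+ k) ^+ N = ((2 ^+ k) ^+ N)^-1 :> R by rewrite !exprVn.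
  by field; rewrite !expf_neq0.
have g_sum : (\sum_(k <oo) \int[P]_w g k w < +oo)%E.
  apply: le_lt_trans; last first.
    apply: (@nneseries_geometric_lty _ (C * (M * 2)%:R ^+ N) (2^-1 `^ (mu - sigma * eta))).
      by rewrite mulr_ge0 // exprn_ge0.
    rewrite powR_gt0 //= [ltRHS](_ : 1 = 1 `^ (mu - sigma * eta)); last by rewrite powR1.
    by rewrite gt0_ltr_powR ?subr_gt0 ?nnegrE //= invf_lt1 // ltr1n.
  apply: lee_nneseries => k *; last exact: g_bound.
  by apply: integral_ge0 => w _; exact: sume_ge0.
have mg k : measurable_fun [set: T] (g k) by exact: emeasurable_sum.
have g0 k w : (0 <= g k w)%E by exact: sume_ge0.
apply: filterS (ae_bounded_summable_integral _ _ _ _ _ mg g0 g_sum) => w [S S0 gS].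
(* Dividing by [coeff] gives |incr|^eta <= S 2^(- k sigma eta) w^(- nu); the claim is its root of
   order [eta]. *)
exists (S `^ eta^-1) => [|k v e wr]; first exact: powR_ge0.
have vM i : (v i < M * 2 ^ k)%N.
  rewrite -(ltr_nat R) natrM natrX -ltr_pdivrMr ?exprn_gt0 //.
  have := coord_le_norm (dyadic k v - t0) i; rewrite !mxE => vi.
  have := coord_le_norm t0 i.
  have := truncnS_gt (`|t0| + r0); rewrite -/M.
  have := ler_norm ((v i)%:R / 2 ^+ k - t0 ord0 i); have := ler_norm (t0 ord0 i).
  have : 0 < 2^-1 ^+ k :> R by rewrite exprn_gt0.
  lra.
pose i : I k := ([ffun j => Ordinal (vM j)], [ffun j => e j]).
have vi : vI k i = v by apply/funext => j; rewrite /vI ffunE.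
have ei : eI k i = e by apply/funext => j; rewrite /eI ffunE.
have : ((coeff k v)%:E * (`|incr k v e w| `^ eta)%:E <= S%:E)%E.
  apply: le_trans (gS k); rewrite /g (bigD1 i) //= vi ei leeDl //.
  by apply: sume_ge0.
rewrite -EFinM lee_fin /coeff wr.
have h0 : 0 < 2^-1 ^+ k :> R by rewrite exprn_gt0.
have w0 := weight_gt0 k v.
have a0 := powR_gt0 (sigma * eta) h0; have b0 := powR_gt0 (- nu) w0.
have -> : (2^-1 ^+ k) `^ (- (sigma * eta)) * weight k v `^ nu =
    ((2^-1 ^+ k) `^ (sigma * eta) * weight k v `^ (- nu))^-1.
  by rewrite invfM -!powRN opprK.
rewrite mulrC ler_pdivrMr ?mulr_gt0 // => hS.
have /(ge0_ler_powR (r := eta^-1)) := hS.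
rewrite !nnegrE powR_ge0 !mulr_ge0 ?(ltW a0) ?(ltW b0) ?invr_ge0 ?(ltW eta_gt0) //
  => /(_ isT isT isT).
rewrite -powRrM mulfV ?gt_eqF // powRr1 //.
rewrite powRM // ?mulr_ge0 ?(ltW a0) ?(ltW b0) // powRM ?(ltW a0) ?(ltW b0) //.
by rewrite -!powRrM mulfK ?gt_eqF // mulNr mulrA.
Qed.

End DyadicMoments.

(** * From a local modulus of continuity to the microlocal space and the frontier *)

Lemma ex_lt_fraction (R : realType) (a x : R) : 0 < a -> x < a ->
  exists n, x < a * (1 - n.+2%:R^-1).
Proof.
move=> a0 xa.
have [n _ /(_ n (leqnn n)) /= an] : \forall n \near \oo, a * n.+1%:R^-1 < a - x.
  have : a * harmonic n @[n --> \oo] --> a * 0 by apply: cvgM (cvg_cst a) (@cvg_harmonic R).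
  rewrite mulr0 => /(@cvgrPdist_lt R R^o) /(_ (a - x)); rewrite subr_gt0 => /(_ xa).
  by apply: filterS => n /=; rewrite sub0r normrN; apply: le_lt_trans; exact: ler_norm.
exists n; rewrite mulrBr mulr1 ltrBrDl -ltrBrDr; apply: le_lt_trans an.
by rewrite ler_pM2l // lef_pV2 ?posrE ?ltr0n // ler_nat.
Qed.

Section Frontier.
Context {R : realType} {N : nat} (nrm : 'rV[R]_N -> R) (hnrm : is_norm nrm).
Context (t0 : 'rV[R]_N) (f : 'rV[R]_N -> R).

(** The [microlocal] estimate with exponent sigma = s + s', but with [t0] itself allowed as a point,
    as in the balls defining the frontier. *)
Definition local_modulus (sigma s' : R) : Prop :=
  exists delta K : R, [/\ 0 < delta, 0 <= K &
    forall t u, orthant t -> orthant u ->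
      nrm (t - t0) < delta -> nrm (u - t0) < delta ->
      `|f t - f u| <= K * nrm (t - u) `^ sigma * (nrm (t - t0) + nrm (t - u)) `^ (- s')].

Let distn_le t u : nrm (t - u) <= nrm (t - t0) + nrm (u - t0).
Proof.
have [_ _ nD] := hnrm; rewrite -(is_normN hnrm (u - t0)).
by have := nD (t - t0) (- (u - t0)); rewrite opprB addrA subrK.
Qed.

Lemma local_modulus_microlocal (tau sigma s' : R) : sigma <= tau ->
  local_modulus tau s' -> microlocal nrm t0 (sigma - s') s' f.
Proof.
move=> st [delta [K [d0 K0 hK]]].
(* Radius 1/2 forces nrm (t - u) < 1, so lowering the exponent from [tau] to [sigma] enlarges the
   power; K + 1 makes the constant positive. *)
exists (Num.min delta 2^-1), (K + 1); split; first by rewrite lt_min d0 invr_gt0 ltr0n.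
  by rewrite ltr_wpDl.
move=> t u ot ou /andP[_]; rewrite lt_min => /andP[td t2] /andP[_].
rewrite lt_min => /andP[ud u2]; rewrite subrK.
have [->|tu] := eqVneq t u.
  by rewrite subrr normr0 !mulr_ge0 ?powR_ge0 // addr_ge0.
apply: le_trans (hK _ _ ot ou td ud) _.
have tu0 : 0 < nrm (t - u) by apply: is_norm_gt0; rewrite // subr_eq0.
rewrite ler_wpM2r ?powR_ge0 //; apply: ler_pM; rewrite ?powR_ge0 //.
  by rewrite lerDl.
by rewrite ger_powR // tu0 (le_trans (distn_le _ _)) //; lra.
Qed.

(** In a ball of radius rho < delta, |t - t0| + |t - u| is at most 3 rho, and - s' >= 0, so every
    quotient is at most K * 3^(- s'). *)
Lemma local_modulus_limf_esup (sigma s' : R) : s' <= 0 ->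
  local_modulus sigma s' ->
  (limf_esup (increment_sup nrm t0 f sigma s') (0 : R)^'+ < +oo)%E.
Proof.
move=> s0 [delta [K [d0 K0 hK]]].
apply: (@le_lt_trans _ _ (K * 3 `^ (- s'))%:E); last exact: ltry.
apply: (@le_trans _ _ (ereal_sup (increment_sup nrm t0 f sigma s' @` `]0, delta[))).
  apply: ereal_inf_lbound; exists `]0, delta[%classic => //.
  apply: filterS2 (nbhs_right_gt 0) (nbhs_right_lt d0) => x x0 xd.
  by rewrite /= in_itv /= x0 xd.
apply: ge_ereal_sup => _ [rho + <-]; rewrite /= in_itv /= => /andP[rho0 rhod].
apply: ge_ereal_sup => _ [[t u] /= [[ot tr] [ou ur] tu] <-].
have tu0 : 0 < nrm (t - u) by apply: is_norm_gt0; rewrite // subr_eq0.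
rewrite lee_fin ler_pdivrMr ?mulr_gt0 ?powR_gt0 //.
apply: le_trans (hK _ _ ot ou (lt_trans tr rhod) (lt_trans ur rhod)) _.
rewrite [leRHS](_ : _ = K * nrm (t - u) `^ sigma *
  (3 `^ (- s') * rho `^ (- s'))); last by ring.
rewrite ler_wpM2l ?mulr_ge0 ?powR_ge0 // -powRM // ?(ltW rho0) //.
have t0' := is_norm_ge0 hnrm (t - t0).
rewrite ge0_ler_powR ?oppr_ge0 ?nnegrE ?addr_ge0 ?(ltW tu0) ?mulr_ge0 ?(ltW rho0) //.
have := distn_le t u; lra.
Qed.

(** The frontier is a supremum, so admissible exponents increasing to [sigma] suffice; the index n +
    2 keeps them positive. *)
Lemma le_frontier (sigma s' : R) : 0 < sigma ->
  (forall n, (limf_esup (increment_sup nrm t0 f (sigma * (1 - n.+2%:R^-1)) s')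
     (0 : R)^'+ < +oo)%E) ->
  (sigma%:E <= frontier nrm t0 f s')%E.
Proof.
move=> s0 h; have ub n : ((sigma * (1 - n.+2%:R^-1))%:E <= frontier nrm t0 f s')%E.
  apply: ereal_sup_ubound; exists (sigma * (1 - n.+2%:R^-1)) => //; exact: h.
move: ub; case: (frontier nrm t0 f s') => [r| |] ub; rewrite ?leey //; last by have := ub 0%N.
rewrite lee_fin leNgt; apply/negP => /(ex_lt_fraction _ _ _ s0)[n].
by apply/negP; rewrite -leNgt -lee_fin.
Qed.

End Frontier.

(** * Almost sure modulus for the given norm, and the conclusion *)

Lemma ae_local_modulus (R : realType) (d : measure_display)
  (T : measurableType d) (P : probability T R)
  (N : nat)
  (nrm : 'rV[R]_N -> R) (hnrm : is_norm nrm)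
  (X : 'rV[R]_N -> {RV P >-> R})
  (hX : {ae P, forall w, cadlag (fun t => X t w)})
  (t0 : 'rV[R]_N)
  (eta mu nu C rho0 sigma : R)
  (heta : 0 < eta) (hnu : nu < 0)
  (hC : 0 < C) (hrho0 : 0 < rho0) (sigma_gt0 : 0 < sigma) (sigma_lt : sigma < mu / eta)
  (hE : forall rho : R, 0 < rho < rho0 ->
     forall t u : 'rV[R]_N, oball nrm t0 rho t -> oball nrm t0 rho u ->
     (('E_P [fun w => (`|X t w - X u w| `^ eta)%R])%E
        <= (C * nrm (t - u) `^ (N%:R + mu) * rho `^ (- nu))%:E)%E) :
  {ae P, forall w, local_modulus nrm t0 (fun t => X t w) sigma (nu / eta)}.
Proof.
have [A A0 nA] := is_norm_le_max hnrm; have [B B0 Bn] := max_le_is_norm hnrm.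
have gamma0 : 0 <= - (nu / eta) by rewrite -mulNr divr_ge0 ?oppr_ge0 ?(ltW hnu) ?(ltW heta).
have se : sigma * eta < mu by rewrite -ltr_pdivlMr.
have mu0 : 0 < mu by apply: lt_trans se; rewrite mulr_gt0.
(* Both ends of an edge of weight W are within max-distance W of [t0], so within A W for [nrm]; the
   radius 2 A W makes this strict, and it is below [rho0] as soon as W < r0. *)
pose r0 := rho0 / (2 * A).
have r00 : 0 < r0 by rewrite divr_gt0 // mulr_gt0.
have moment k (v : 'I_N -> nat) (e : 'I_N -> bool) :
  `|dyadic k v - t0| + 2^-1 ^+ k < r0 ->
  (\int[P]_w (`|X (dyadic k v) w - X (dyadic k (fun i => v i + e i)%N) w| `^ eta)%:E <=
   (C * A `^ (N%:R + mu) * (2 * A) `^ (- nu) * (2^-1 ^+ k) `^ (N%:R + mu)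
    * (`|dyadic k v - t0| + 2^-1 ^+ k) `^ (- nu))%:E)%E.
  set W := `|_| + _ => Wr.
  have h0 : 0 < 2^-1 ^+ k :> R by rewrite exprn_gt0.
  have W0 : 0 < W by rewrite ltr_wpDl.
  have AW0 : 0 < A * W by rewrite mulr_gt0.
  have ball x : orthant x -> `|x - t0| <= W -> oball nrm t0 (2 * A * W) x.
    move=> ox xW; split=> //; apply: (le_lt_trans (nA _)).
    have : A * `|x - t0| <= A * W by rewrite ler_pM2l.
    lra.
  have rho : 0 < 2 * A * W < rho0.
    by rewrite !mulr_gt0 //= -ltr_pdivlMl ?mulr_gt0 // mulrC.
  have b1 : oball nrm t0 (2 * A * W) (dyadic k v).
    by apply: ball; [exact: orthant_dyadic|rewrite /W lerDl ltW].
  have b2 : oball nrm t0 (2 * A * W) (dyadic k (fun i => v i + e i)%N).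
    apply: ball; first exact: orthant_dyadic.
    apply: (le_trans (ler_distD (dyadic k v) _ _)).
    by rewrite addrC lerD2l distrC dyadicD_dist.
  have := hE _ rho _ _ b1 b2; rewrite unlock => /le_trans; apply; rewrite lee_fin.
  rewrite (@powRM _ (2 * A)) ?mulr_ge0 ?(ltW A0) ?(ltW W0) //.
  rewrite [leRHS](_ : _ = C * (A `^ (N%:R + mu) * (2^-1 ^+ k) `^ (N%:R + mu)) *
    ((2 * A) `^ (- nu) * W `^ (- nu))); last by ring.
  rewrite ler_wpM2r ?mulr_ge0 ?powR_ge0 // ler_wpM2l ?(ltW hC) //.
  rewrite -powRM ?(ltW A0) ?(ltW h0) // ge0_ler_powR ?nnegrE ?is_norm_ge0 //.
  - by rewrite addr_ge0 // ltW.
  - exact: mulr_ge0 (ltW A0) (ltW h0).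
  - by apply: (le_trans (nA _)); rewrite ler_pM2l //; exact: dyadicD_dist.
have C1 : 0 <= C * A `^ (N%:R + mu) * (2 * A) `^ (- nu).
  by rewrite !mulr_ge0 ?powR_ge0 // ltW.
have := ae_dyadic_increments P X t0 r0 eta mu nu sigma _ heta C1 se moment.
apply: filterS2 hX => w cX [K K0 hK].
have right t : orthant t ->
    X u w @[u --> within [set u : 'rV[R]_N | forall i, t ord0 i <= u ord0 i] (nbhs t)] --> X t w.
  by move=> /cX[].
have [delta [K' [d0 K'0 hK']]] :=
  dyadic_chaining (fun t => X t w) t0 r0 sigma (- (nu / eta)) K
  r00 sigma_gt0 gamma0 K0 right hK.
(* As |x| <= B nrm x, the [nrm]-ball of radius delta / B lies in the max-ball of radius [delta]; the
   two powers of B come from the two factors of the modulus. *)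
exists (delta / B), (K' * B `^ sigma * B `^ (- (nu / eta))); split; first exact: divr_gt0.
  by rewrite !mulr_ge0 ?powR_ge0.
move=> t u ot ou td ud.
have lt_delta x : nrm (x - t0) < delta / B -> `|x - t0| < delta.
  by move=> xd; apply: (le_lt_trans (Bn _)); rewrite mulrC -ltr_pdivlMr.
apply: (le_trans (hK' _ _ ot ou (lt_delta _ td) (lt_delta _ ud))).
have ntu := is_norm_ge0 hnrm (t - u); have nt := is_norm_ge0 hnrm (t - t0).
rewrite [leRHS](_ : _ = K' * (B `^ sigma * nrm (t - u) `^ sigma) *
  (B `^ (- (nu / eta)) * (nrm (t - t0) + nrm (t - u)) `^ (- (nu / eta)))); last by ring.
rewrite -!powRM ?addr_ge0 ?(ltW B0) //.
apply: ler_pM; rewrite ?mulr_ge0 ?powR_ge0 //.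
  by rewrite ler_wpM2l // ge0_ler_powR ?nnegrE ?mulr_ge0 ?(ltW B0) ?(ltW sigma_gt0).
rewrite ge0_ler_powR ?nnegrE ?addr_ge0 ?mulr_ge0 ?addr_ge0 ?(ltW B0) //.
by rewrite mulrDr lerD.
Qed.

Theorem proposition3p3 (R : realType) (d : measure_display)
  (T : measurableType d) (P : probability T R)
  (N : nat) (hN : (1 <= N)%N)
  (nrm : 'rV[R]_N -> R) (hnrm : is_norm nrm)
  (X : 'rV[R]_N -> {RV P >-> R})
  (hX : {ae P, forall w, cadlag (fun t => X t w)})
  (t0 : 'rV[R]_N) (ht0 : orthant t0)
  (hD : {ae P, forall w,
     frontier_graph nrm t0 (fun t => X t w) `&` @regionD R !=set0})
  (eta mu nu C rho0 : R)
  (heta : 0 < eta) (hmu : 0 < mu) (hnu : nu < 0)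
  (hC : 0 < C) (hrho0 : 0 < rho0)
  (hE : forall rho : R, 0 < rho < rho0 ->
     forall t u : 'rV[R]_N, oball nrm t0 rho t -> oball nrm t0 rho u ->
     (('E_P [fun w => (`|X t w - X u w| `^ eta)%R])%E
        <= (C * nrm (t - u) `^ (N%:R + mu) * rho `^ (- nu))%:E)%E) :
  {ae P, forall w, forall sigma : R, sigma < mu / eta ->
     microlocal nrm t0 (sigma - nu / eta) (nu / eta) (fun t => X t w)} /\
  {ae P, forall w, ((mu / eta)%:E <= frontier nrm t0 (fun t => X t w) (nu / eta))%E}.
Proof.
(* Countably many exponents increasing to mu / eta: their almost sure events can be intersected, and
   every other [sigma] is then handled path by path. *)
pose tau n := mu / eta * (1 - n.+2%:R^-1).
have me0 : 0 < mu / eta by rewrite divr_gt0.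
have tau_itv n : 0 < tau n < mu / eta.
  rewrite /tau mulr_gt0 ?subr_gt0 ?invf_lt1 ?ltr0n ?ltr1n //=.
  by rewrite gtr_pMr // ltrBlDr ltrDl invr_gt0 ltr0n.
have modulus : {ae P, forall w n,
    local_modulus nrm t0 (fun t => X t w) (tau n) (nu / eta)}.
  apply: ae_foralln => n; have /andP[tn0 tn] := tau_itv n.
  exact: (ae_local_modulus _ _ _ P _ _ hnrm X hX t0 eta mu nu C rho0 (tau n)).
have nue : nu / eta <= 0 by rewrite ler_pdivrMr // mul0r ltW.
split; apply: filterS modulus => w modulus.
  move=> sigma sm.
  have [n /ltW sn] := ex_lt_fraction _ _ _ me0 sm.
  exact: (local_modulus_microlocal _ hnrm _ _ _ _ _ sn (modulus n)).
by apply: le_frontier => // n; exact: (local_modulus_limf_esup _ hnrm _ _ _ _ nue (modulus n)).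
Qed.
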